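(* Let $m=\sqrt{(s_0-t_0)(s_1-t_1)}$. Then, as formal power series in $u$, $$\frac{H_0(s_0,s_1,t_0,t_1,q,u)}{s_0-t_0}=\frac{\big(s_1-t_1\cosh_q(mu)\big)\cosh_B(mu;q)+t_1\sinh_q(mu)\sinh_B(mu;q)}{s_0s_1-(t_0s_1+s_0t_1)\cosh_q(mu)+t_0t_1\,\mathrm{e}_q(mu)\,\mathrm{e}_q(-mu)},$$ $$H_1(s_0,s_1,t_0,t_1,q,u)=\frac{m\Big(\big(s_0-t_0\cosh_q(mu)\big)\sinh_B(mu;q)+t_0\sinh_q(mu)\cosh_B(mu;q)\Big)}{s_0s_1-(s_1t_0+t_1s_0)\cosh_q(mu)+t_0t_1\,\mathrm{e}_q(mu)\,\mathrm{e}_q(-mu)}.$$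
   Context: $\mathfrak{B}_n$ is the group of permutations $w$ of $\{\pm1,\dots,\pm n\}$ with $w(-i)=-w(i)$; write $w_i=w(i)$ and set $w_0=0$. For $w\in\mathfrak{B}_n$: $\mathrm{edes}_B(w)$, $\mathrm{odes}_B(w)$ are the numbers of even, resp. odd, $i\in\{0,\dots,n-1\}$ with $w_i>w_{i+1}$; $\mathrm{easc}_B(w)$, $\mathrm{oasc}_B(w)$ are the numbers of even, resp. odd, $i\in\{0,\dots,n-1\}$ with $w_i<w_{i+1}$. The type B inversion number is $$\mathrm{inv}_B(w)=|\{1\le i<j\le n:w_i>w_j\}|+|\{1\le i<j\le n:-w_i>w_j\}|+|\{1\le i\le n:w_i<0\}|.$$ Define $B_n(s_0,s_1,t_0,t_1,q)=\sum_{w\in\mathfrak{B}_n}s_0^{\mathrm{easc}_B(w)}s_1^{\mathrm{oasc}_B(w)}t_0^{\mathrm{edes}_B(w)}t_1^{\mathrm{odes}_B(w)}q^{\mathrm{inv}_B(w)}$, $B_n(1,q)=\sum_{w\in\mathfrak{B}_n}q^{\mathrm{inv}_B(w)}$ (both $1$ for $n=0$), and $$H_0(s_0,s_1,t_0,t_1,q,u)=\sum_{k\ge0}B_{2k}(s_0,s_1,t_0,t_1,q)\frac{u^{2k}}{B_{2k}(1,q)},\quad H_1(s_0,s_1,t_0,t_1,q,u)=\sum_{k\ge0}B_{2k+1}(s_0,s_1,t_0,t_1,q)\frac{u^{2k+1}}{B_{2k+1}(1,q)}.$$ $[j]_q=1+q+\cdots+q^{j-1}$, $[n]_q!=\prod_{j=1}^n[j]_q$,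 $\mathrm{e}_q(u)=\sum_{n\ge0}u^n/[n]_q!$, $\cosh_q(u)=\frac{\mathrm{e}_q(u)+\mathrm{e}_q(-u)}2$, $\sinh_q(u)=\frac{\mathrm{e}_q(u)-\mathrm{e}_q(-u)}2$; $\exp_B(u;q)=\sum_{n\ge0}u^n/B_n(1,q)$, $\cosh_B(u;q)=\frac{\exp_B(u;q)+\exp_B(-u;q)}2$, $\sinh_B(u;q)=\frac{\exp_B(u;q)-\exp_B(-u;q)}2$. Here $s_0,s_1,t_0,t_1,q$ are indeterminates and the identities are between formal power series in $u$ over the field $\mathbb{Q}(s_0,s_1,t_0,t_1,q)(m)$. *)

(* Defs.v *)
From HB Require Import structures.
From mathcomp Require Import all_boot all_order all_algebra all_fingroup.
From mathcomp Require Import all_field.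
From mathcomp Require Import boolp mpoly.

Set Implicit Arguments.
Unset Strict Implicit.
Unset Printing Implicit Defensive.

Import GRing.Theory Num.Theory.
Local Open Scope ring_scope.

Record fps (R : Type) := Fps { fps_coef : nat -> R }.

Notation "f `[ n ]" := (fps_coef f n)
  (at level 2, left associativity, format "f `[ n ]") : ring_scope.

HB.instance Definition _ (R : Type) := gen_eqMixin (fps R).
HB.instance Definition _ (R : Type) := gen_choiceMixin (fps R).

Lemma fpsP (R : Type) (f g : fps R) : (forall n, f`[n] = g`[n]) <-> f = g.
Proof.
by split=> [|->//]; case: f g => [f] [g] /= fg; congr Fps; apply: funext.
Qed.

Section FpsRing.
Variable R : comNzRingType.
Implicit Types f g h : fps R.

Definition fpsC (c : R) : fps R := Fps (fun n => if n is 0%N then c else 0).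
Definition fps_add f g := Fps (fun n => f`[n] + g`[n]).
Definition fps_opp f := Fps (fun n => - f`[n]).
Definition fps_mul f g := Fps (fun n => \sum_(i < n.+1) f`[i] * g`[n - i]).

Fact fps_addA : associative fps_add.
Proof. by move=> f g h; apply/fpsP=> n /=; rewrite addrA. Qed.
Fact fps_addC : commutative fps_add.
Proof. by move=> f g; apply/fpsP=> n /=; rewrite addrC. Qed.
Fact fps_add0 : left_id (fpsC 0) fps_add.
Proof. by move=> f; apply/fpsP=> -[|n] /=; rewrite add0r. Qed.
Fact fps_addN : left_inverse (fpsC 0) fps_opp fps_add.
Proof. by move=> f; apply/fpsP=> -[|n] /=; rewrite addNr. Qed.

HB.instance Definition _ :=
  GRing.isZmodule.Build (fps R) fps_addA fps_addC fps_add0 fps_addN.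

Let trunc N f : {poly R} := \poly_(i < N) f`[i].

Let truncM N f g n : (n < N)%N -> (fps_mul f g)`[n] = (trunc N f * trunc N g)`_n.
Proof.
move=> nN; rewrite coefM /=; apply: eq_bigr => i _; rewrite !coef_poly.
by rewrite (leq_ltn_trans (leq_ord i) nN) (leq_ltn_trans (leq_subr i n) nN).
Qed.

Fact fps_mulC : commutative fps_mul.
Proof.
by move=> f g; apply/fpsP=> n; rewrite !(truncM _ _ (ltnSn n)) mulrC.
Qed.
Fact fps_mulA : associative fps_mul.
Proof.
move=> f g h; apply/fpsP=> n.
have E N f1 g1 k : (k < N)%N ->
    (trunc N (fps_mul f1 g1))`_k = (trunc N f1 * trunc N g1)`_k.
  by move=> kN; rewrite coef_poly kN (truncM _ _ kN).
rewrite !(truncM _ _ (ltnSn n)).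
transitivity ((trunc n.+1 f * (trunc n.+1 g * trunc n.+1 h))`_n).
  rewrite coefM [RHS]coefM; apply: eq_bigr => i _.
  by rewrite E // ltnS leq_subr.
by rewrite mulrA coefM [RHS]coefM; apply: eq_bigr => i _; rewrite E.
Qed.
Fact fps_mul1 : left_id (fpsC 1) fps_mul.
Proof.
move=> f; apply/fpsP=> n /=; rewrite big_ord_recl /= mul1r subn0.
by rewrite big1 ?addr0 // => i _; rewrite mul0r.
Qed.
Fact fps_mulDl : left_distributive fps_mul fps_add.
Proof.
move=> f g h; apply/fpsP=> n /=; rewrite -big_split /=.
by apply: eq_bigr => i _; rewrite mulrDl.
Qed.
Fact fps_oner_neq0 : fpsC 1 != 0 :> fps R.
Proof. by apply/eqP=> /fpsP/(_ 0%N)/eqP; rewrite oner_eq0. Qed.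

HB.instance Definition _ := GRing.Zmodule_isComNzRing.Build (fps R)
  fps_mulA fps_mulC fps_mul1 fps_mulDl fps_oner_neq0.

Lemma fps_coef0 n : (0 : fps R)`[n] = 0. Proof. by case: n. Qed.
Lemma fps_coef1 n : (1 : fps R)`[n] = (n == 0%N)%:R. Proof. by case: n. Qed.
Lemma fps_coefD f g n : (f + g)`[n] = f`[n] + g`[n]. Proof. by []. Qed.
Lemma fps_coefN f n : (- f)`[n] = - f`[n]. Proof. by []. Qed.
Lemma fps_coefM f g n : (f * g)`[n] = \sum_(i < n.+1) f`[i] * g`[n - i].
Proof. by []. Qed.

Fact fpsC_is_zmod_morphism : zmod_morphism fpsC.
Proof. by move=> a b; apply/fpsP=> -[|n] //=; rewrite oppr0 addr0. Qed.
HB.instance Definition _ :=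
  GRing.isZmodMorphism.Build R (fps R) fpsC fpsC_is_zmod_morphism.
Fact fpsC_is_monoid_morphism : monoid_morphism fpsC.
Proof.
split=> // a b; apply/fpsP=> -[|n]; rewrite fps_coefM big_ord_recl /=.
  by rewrite big_ord0 addr0.
by rewrite mulr0 add0r big1 // => i _; rewrite mul0r.
Qed.
HB.instance Definition _ :=
  GRing.isMonoidMorphism.Build R (fps R) fpsC fpsC_is_monoid_morphism.

(** The substitution u |-> c u. *)
Definition fps_at f (c : R) : fps R := Fps (fun n => f`[n] * c ^+ n).

End FpsRing.

Notation "c %:S" := (fpsC c) (at level 2, left associativity, format "c %:S")
  : ring_scope.

Section FpsUnitRing.
Variable R : comUnitRingType.
Implicit Types f g : fps R.

Definition fps_unit : pred (fps R) := fun f => f`[0] \is a GRing.unit.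

(** The first n coefficients of 1 / f. *)
Fixpoint fps_inv_seq f n : seq R :=
  if n is k.+1 then
    let s := fps_inv_seq f k in
    rcons s (if k is 0%N then f`[0]^-1
             else - f`[0]^-1 * \sum_(i < k) f`[k - i] * s`_i)
  else [::].

Definition fps_inv f : fps R :=
  if fps_unit f then Fps (fun n => (fps_inv_seq f n.+1)`_n) else f.

Let size_inv f n : size (fps_inv_seq f n) = n.
Proof. by elim: n => //= n IHn; rewrite size_rcons IHn. Qed.

Let nth_inv f n k : (k < n)%N ->
  (fps_inv_seq f n)`_k = (fps_inv_seq f k.+1)`_k.
Proof.
elim: n => // n IHn; rewrite ltnS leq_eqVlt => /predU1P[-> //|kn].
by rewrite [fps_inv_seq f n.+1]/= nth_rcons size_inv kn IHn.
Qed.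

Fact fps_mulVx : {in fps_unit, left_inverse 1 fps_inv *%R}.
Proof.
move=> f Uf; rewrite /fps_inv (Uf : fps_unit f).
apply/fpsP=> n; rewrite fps_coefM fps_coef1 big_ord_recr /= nth_rcons size_inv.
rewrite ltnn eqxx subnn; case: n => [|n] /=.
  by rewrite big_ord0 add0r mulVr.
rewrite mulrC mulrA mulrN divrr // mulN1r; apply/eqP; rewrite subr_eq0.
apply/eqP/eq_bigr=> i _; rewrite [LHS]mulrC; congr (_ * _).
exact/esym/(@nth_inv f n.+1 i (ltn_ord i)).
Qed.

Fact fps_unitPl f g : g * f = 1 -> fps_unit f.
Proof.
move=> /fpsP/(_ 0%N); rewrite fps_coefM big_ord1 /= => gf.
by apply/unitrPr; exists g`[0]; rewrite mulrC.
Qed.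

Fact fps_inv_out : {in [predC fps_unit], fps_inv =1 id}.
Proof. by move=> f Uf; rewrite /fps_inv ifN. Qed.

HB.instance Definition _ := GRing.ComNzRing_hasMulInverse.Build (fps R)
  fps_mulVx fps_unitPl fps_inv_out.

Lemma fps_unitE f : (f \is a GRing.unit) = (f`[0] \is a GRing.unit).
Proof. by []. Qed.

End FpsUnitRing.

(** [(i, false)] stands for the letter i+1 and [(i, true)] for -(i+1). *)
Notation letter n := ('I_n * bool)%type.

Definition letter_opp n (x : letter n) : letter n := (x.1, ~~ x.2).
Definition letter_val n (x : letter n) : int :=
  if x.2 then - (x.1.+1)%:Z else (x.1.+1)%:Z.

Definition signed_perm n : {set {perm letter n}} :=
  [set w : {perm letter n} | [forall x, w (letter_opp x) == letter_opp (w x)]].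

(** [sp_val w i] is w_i for 0 <= i <= n, with w_0 = 0. *)
Definition sp_val n (w : {perm letter n}) (i : nat) : int :=
  if i is k.+1 then
    if insub k is Some j then letter_val (w (j, false)) else 0
  else 0.

Section Statistics.
Variables (n : nat) (w : {perm letter n}).

Definition edesB : nat :=
  #|[set i : 'I_n | ~~ odd i & sp_val w i > sp_val w i.+1]|.
Definition odesB : nat :=
  #|[set i : 'I_n | odd i & sp_val w i > sp_val w i.+1]|.
Definition eascB : nat :=
  #|[set i : 'I_n | ~~ odd i & sp_val w i < sp_val w i.+1]|.
Definition oascB : nat :=
  #|[set i : 'I_n | odd i & sp_val w i < sp_val w i.+1]|.

(** The positions 1, ..., n are the [i.+1] with [i : 'I_n]. *)
Definition invB : nat :=
  (#|[set p : 'I_n * 'I_n | (p.1 < p.2)%N &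
        (sp_val w p.1.+1 > sp_val w p.2.+1)%R]|
   + #|[set p : 'I_n * 'I_n | (p.1 < p.2)%N &
        (- sp_val w p.1.+1 > sp_val w p.2.+1)%R]|
   + #|[set i : 'I_n | (sp_val w i.+1 < 0)%R]|)%N.

End Statistics.

Section Series.
Variable K : fieldType.

Definition eulerB n (s0 s1 t0 t1 q : K) : K :=
  \sum_(w in signed_perm n)
    s0 ^+ eascB w * s1 ^+ oascB w * t0 ^+ edesB w * t1 ^+ odesB w * q ^+ invB w.

(** [eulerB1 n q] is B_n(1, q). *)
Definition eulerB1 n (q : K) : K := \sum_(w in signed_perm n) q ^+ invB w.

Definition H0 (s0 s1 t0 t1 q : K) : fps K :=
  Fps (fun n => if odd n then 0 else eulerB n s0 s1 t0 t1 q / eulerB1 n q).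
Definition H1 (s0 s1 t0 t1 q : K) : fps K :=
  Fps (fun n => if odd n then eulerB n s0 s1 t0 t1 q / eulerB1 n q else 0).

Definition qint j (q : K) : K := \sum_(i < j) q ^+ i.
Definition qfact n (q : K) : K := \prod_(1 <= j < n.+1) qint j q.

Definition exp_q (q : K) : fps K := Fps (fun n => (qfact n q)^-1).
Definition exp_B (q : K) : fps K := Fps (fun n => (eulerB1 n q)^-1).

(** The even and odd parts, evaluated at m u. *)
Definition cosh_of (e : fps K) (m : K) : fps K :=
  (fps_at e m + fps_at e (- m)) / 2%:R.
Definition sinh_of (e : fps K) (m : K) : fps K :=
  (fps_at e m - fps_at e (- m)) / 2%:R.

End Series.

Definition Qstq : fieldType := {fraction {mpoly rat[5]}}.
Definition indet (i : nat) : Qstq := tofrac ('X_(inord i) : {mpoly rat[5]}).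

(* Main.v *)
Require Import Defs.
From HB Require Import structures.
From mathcomp Require Import all_boot all_order all_algebra all_fingroup.
From mathcomp Require Import all_field.
From mathcomp Require Import boolp mpoly.
From mathcomp Require Import zify ring.
Import Order.TTheory GRing.Theory Num.Theory.
Local Open Scope ring_scope.

(** Let [x_i = s_i - t_i] and read the indices of [s], [t] and [x] modulo 2.
    The weight of a position [i] of a signed permutation is [t_i + x_i] at an
    ascent and [t_i] at a descent, so it is [t_i] plus [x_i] times the indicator
    of an ascent.  Expand the product of the weights according to the last
    position [j] at which the term [t_j] is taken: the positions after [j] are
    then forced to be ascents, and position [j] is unconstrained.  A signed
    permutation of size [n] whose last [n - j] entries increase is a signed
    permutation of size [j] (the pattern of its first [j] entries) together with
    the choice of its last entries, and the two contribute independently to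
    [inv_B].  If [f_n = B_n(s0, s1, t0, t1, q) / B_n(1, q)], this gives
    (lemma [eulerB_recurrence])

      f_n = x_0 ... x_(n-1) / B_n(1, q)
            + sum_(j < n) f_j t_j x_(j+1) ... x_(n-1) / [n-j]_q! .

    As the [x_i] alternate and [c^2 = x_0 x_1], the products of the [x_i] are
    powers of [c] up to a factor that depends on the parities only, and the
    recurrence is one linear equation between [H0], [H1], [exp_B] and [e_q]
    (lemma [fps_eulerB_eq]).  It holds for both square roots [c = m] and
    [c = - m]; the half sum and the half difference of the two equations form a
    2 x 2 linear system, whose determinant is the denominator of the theorem up
    to a nonzero scalar and whose solution by Cramer's rule is the theorem (lemma
    [parity_system_solution]).

    The combinatorial input is the factorisation over the last block.  Signed
    permutations are built by appending one last letter at a time (lemma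
    [big_signed_perm_ins]); the number of inversions this adds depends on the
    letter only (lemma [invB_ins]), and whether it creates an ascent depends on
    the new and the previous last letter only.  Hence the sum over increasing
    blocks is an iterated sum over letters.  Such a block consists of negative
    letters followed by positive ones, and the letters of each sign are encoded
    by a weakly decreasing sequence, so that the sum over the blocks is a sum
    [neg_block] of products of two q-binomial coefficients.  The q-binomial theorem evaluates it as
    B_(m+d)(1, q) / (B_m(1, q) [d]_q!) (lemmas [neg_block_qfact] and
    [eulerB1_block]). *)

Set Implicit Arguments.
Unset Strict Implicit.
Unset Printing Implicit Defensive.

Arguments sp_val : simpl never.

(** * Gaussian binomials as sums over decreasing sequences *)

Section QBinomial.
Variables (K : fieldType) (q : K).

(** The generating function of the sequences [c >= c_1 >= ... >= c_r >= 0] by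
    their sum: the Gaussian binomial coefficient [c + r] choose [r]. *)
Fixpoint qbin (c r : nat) : K :=
  if r is r'.+1 then \sum_(i < c.+1) q ^+ i * qbin i r' else 1.

#[global] Arguments qbin : simpl never.

Lemma qbinS c r : qbin c r.+1 = \sum_(i < c.+1) q ^+ i * qbin i r.
Proof. by []. Qed.

Lemma qbin0l r : qbin 0 r = 1.
Proof. by elim: r => // r IHr; rewrite qbinS big_ord1 IHr mulr1. Qed.

Lemma qbinSS c r : qbin c.+1 r.+1 = qbin c r.+1 + q ^+ c.+1 * qbin c.+1 r.
Proof. by rewrite !qbinS big_ord_recr. Qed.

Lemma qintD a b : qint (a + b) q = qint a q + q ^+ a * qint b q.
Proof.
rewrite /qint big_split_ord /= mulr_sumr; congr (_ + _).
by apply: eq_bigr => i _; rewrite exprD.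
Qed.

Lemma qfact0 : qfact 0 q = 1.
Proof. by rewrite /qfact big_geq. Qed.

Lemma qfactS n : qfact n.+1 q = qfact n q * qint n.+1 q.
Proof. by rewrite /qfact big_nat_recr. Qed.

Lemma qfact_neq0 : (forall j, qint j.+1 q != 0) -> forall n, qfact n q != 0.
Proof.
move=> qint_neq0; elim=> [|n IHn]; first by rewrite qfact0 oner_neq0.
by rewrite qfactS mulf_neq0.
Qed.

Lemma qbin_qfact c r : qbin c r * qfact c q * qfact r q = qfact (c + r) q.
Proof.
elim: c r => [|c IHc] r; first by rewrite qbin0l qfact0 !mul1r.
elim: r => [|r IHr]; first by rewrite qfact0 mul1r mulr1 addn0.
rewrite addSnnS in IHr.
rewrite qbinSS addSn [in RHS]qfactS -addSn [in RHS]qintD mulrDr.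
rewrite -[in X in X * qint c.+1 q]IHc mulrCA -IHr.
rewrite (qfactS c) (qfactS r); ring.
Qed.

(** Induction on [d]: the Pascal rule [qbinSS] for the coefficient of [z ^+ a]
    is the multiplication by the last factor [1 + z * q ^+ d.+1]. *)
Lemma qbinomial_theorem (z : K) d :
  \sum_(a < d.+1) q ^+ 'C(a.+1, 2) * z ^+ a * qbin (d - a) a
  = \prod_(i < d) (1 + z * q ^+ i.+1).
Proof.
elim: d => [|d IHd]; first by rewrite big_ord1 big_ord0 !mul1r.
rewrite [in RHS]big_ord_recr /= -IHd mulrDr mulr1.
rewrite [in LHS]big_ord_recl [in X in _ = X + _]big_ord_recl /= -addrA.
congr (_ + _).
have -> : \sum_(i < d.+1) q ^+ 'C((bump 0 i).+1, 2) * z ^+ bump 0 i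
              * qbin (d.+1 - bump 0 i) (bump 0 i)
  = \sum_(i < d.+1) (if i == d :> nat then 0 else
      q ^+ 'C(i.+2, 2) * z ^+ i.+1 * qbin (d - i.+1) i.+1)
    + \sum_(i < d.+1) q ^+ 'C(i.+1, 2) * z ^+ i * qbin (d - i) i
                      * (z * q ^+ d.+1).
  rewrite -big_split; apply: eq_bigr => -[i ltid] _; rewrite /bump /= add1n subSS.
  have binE : 'C(i.+2, 2) = ('C(i.+1, 2) + i.+1)%N by rewrite binS bin1 addnC.
  (* The term [i = d] has no first Pascal summand, the truncated subtraction
     [d - i.+1] being 0 there instead of -1. *)
  have [eq_id|neq_id] := eqVneq i d.
    by rewrite -eq_id subnn add0r !qbin0l binE exprD (exprS z); ring.
  have -> : (d - i = (d - i.+1).+1)%N by lia.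
  have -> : q ^+ d.+1 = q ^+ i.+1 * q ^+ (d - i.+1).+1.
    by rewrite -exprD; congr (_ ^+ _); lia.
  rewrite qbinSS binE exprD (exprS z).
  move: (q ^+ _.+1) (q ^+ _.+1) (q ^+ 'C(_, _)) (qbin _ _) (qbin _ _) (z ^+ i).
  by move=> *; ring.
rewrite -mulr_suml; congr (_ + _); rewrite big_ord_recr /= eqxx addr0.
apply: eq_bigr => -[i ltid] _ /=; rewrite /bump /= add1n.
by rewrite ifN //; lia.
Qed.

(** The sum over the blocks of [r] increasing letters appended to a signed
    permutation of size [i], where [k] bounds the sequence that encodes the
    negative letters; the index [a] is the number of the negative letters, and the power of [q]
    collects the part of their inversions that does not depend on which letters
    are chosen. *)
Definition neg_block k i r : K :=
  \sum_(a < r.+1) q ^+ (a * i + 'C(a.+1, 2)) * qbin k a * qbin (i + a) (r - a).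

Lemma neg_block0 k i : neg_block k i 0 = 1.
Proof. by rewrite /neg_block big_ord1 !mul1r. Qed.

(** The recursion on the first letter of the block: it is either negative, with
    [i.+1 + l] inversions for some [l <= k], or positive, in which case the whole
    block is positive. *)
Lemma neg_block_rec k i r :
  neg_block k i r.+1
  = q ^+ i.+1 * (\sum_(l < k.+1) q ^+ l * neg_block l i.+1 r) + qbin i r.+1.
Proof.
rewrite /neg_block big_ord_recl addrC /= mul0n addn0 !mul1r.
congr (_ + _); rewrite mulr_sumr.
under [RHS]eq_bigr do rewrite mulr_sumr mulr_sumr.
rewrite exchange_big; apply: eq_bigr => -[a lear] _ /=.
rewrite /bump add1n qbinS addnS addSn subSS mulr_sumr mulr_suml.
apply: eq_bigr => l _.
have -> : (a.+1 * i + 'C(a.+2, 2) = i.+1 + (a * i.+1 + 'C(a.+1, 2)))%N.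
  by rewrite binS bin1; lia.
rewrite exprD; ring.
Qed.

(** For [k = i = m] all the factors but the q-binomial coefficients
    [d] choose [a] come out of the sum, which is then an instance of the
    q-binomial theorem at [z = q ^+ m]. *)
Lemma neg_block_qfact m d : (forall j, qint j.+1 q != 0) ->
  neg_block m m d * qfact d q
  = \prod_(i < d) (qint (m + i).+1 q * (1 + q ^+ (m + i).+1)).
Proof.
move=> qint_neq0; rewrite /neg_block big_split /=.
have -> : \prod_(i < d) qint (m + i).+1 q = qfact (m + d) q / qfact m q.
  elim: d => [|d IHd]; first by rewrite big_ord0 addn0 divff ?qfact_neq0.
  by rewrite big_ord_recr /= IHd addnS qfactS mulrAC.
have -> : \prod_(i < d) (1 + q ^+ (m + i).+1)
    = \prod_(i < d) (1 + q ^+ m * q ^+ i.+1).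
  by apply: eq_bigr => i _; rewrite -addnS exprD.
rewrite -qbinomial_theorem mulr_suml mulr_sumr; apply: eq_bigr => -[a lead] _ /=.
have {}lead : (a <= d)%N by [].
rewrite mulnC exprD exprM.
have Ema := qbin_qfact m a.
have := qbin_qfact (m + a) (d - a); rewrite -addnA subnKC // => <-.
have := qbin_qfact (d - a) a; rewrite subnK // => <-.
rewrite -Ema; field; by rewrite !(qfact_neq0 qint_neq0).
Qed.

End QBinomial.

(** * Appending a last letter to a signed permutation *)

(** The effect on a letter of making room for a new letter of absolute value
    [k.+1]: absolute values above [k] go up by one. *)
Definition bumpz (k : nat) (z : int) : int :=
  if (k%:Z < z)%R then z + 1 else if (z < - k%:Z)%R then z - 1 else z.

Lemma bumpz_mono k : {mono bumpz k : a b / (a < b)%R}.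
Proof.
move=> a b; rewrite /bumpz.
case: (ltP k%:Z a) => ?; case: (ltP k%:Z b) => ?;
  case: (ltP a (- k%:Z)) => ?; case: (ltP b (- k%:Z)) => ?; lia.
Qed.

Lemma bumpzN k z : bumpz k (- z) = - bumpz k z.
Proof.
rewrite /bumpz; case: (ltP k%:Z z) => ?; case: (ltP z (- k%:Z)) => ?;
  case: (ltP k%:Z (- z)) => ?; case: (ltP (- z) (- k%:Z)) => ?; lia.
Qed.

Lemma bumpz0 k : bumpz k 0 = 0.
Proof.
by rewrite /bumpz; case: (ltP k%:Z 0) => ?; case: (ltP 0 (- k%:Z)) => ?; lia.
Qed.

Section Insertion.
Variable n : nat.

Lemma letter_val_lift (k : 'I_n.+1) (y : letter n) :
  letter_val (lift k y.1, y.2) = bumpz k (letter_val y).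
Proof.
case: y => [[j ltjn] b]; rewrite /letter_val /bumpz /= /bump.
case: b.
  case: (ltP k%:Z (- j.+1%:Z)) => ?; case: (ltP (- j.+1%:Z) (- k%:Z)) => ?;
    case: leqP => ?; lia.
case: (ltP k%:Z j.+1%:Z) => ?; case: (ltP j.+1%:Z (- k%:Z)) => ?;
  case: leqP => ?; lia.
Qed.

(** The signed permutation of size [n.+1] with last letter [x] and whose first
    [n] letters have the pattern [v]. *)
Definition ins_fun (x : letter n.+1) (v : {perm letter n}) (y : letter n.+1) :
    letter n.+1 :=
  if unlift ord_max y.1 is Some i
  then let z := v (i, y.2) in (lift x.1 z.1, z.2) else (x.1, x.2 (+) y.2).

Lemma ins_fun_inj x v : injective (ins_fun x v).
Proof.
move=> [i b] [j c]; rewrite /ins_fun /=.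
case: unliftP => [i' ->|->]; case: unliftP => [j' ->|->] //=.
- move=> /pair_equal_spec[/lift_inj E1 E2].
  have /perm_inj[-> ->] // : v (i', b) = v (j', c).
  by rewrite [LHS]surjective_pairing E1 E2 -surjective_pairing.
- by move=> /(congr1 fst)/esym/eqP; rewrite (negPf (neq_lift _ _)).
- by move=> /(congr1 fst)/eqP; rewrite (negPf (neq_lift _ _)).
- by case=> /addbI ->.
Qed.

Definition ins x v : {perm letter n.+1} := perm (@ins_fun_inj x v).

Lemma ins_last x v b : ins x v (ord_max, b) = (x.1, x.2 (+) b).
Proof. by rewrite permE /ins_fun unlift_none. Qed.

Lemma ins_lift x v i b :
  ins x v (lift ord_max i, b) = (lift x.1 (v (i, b)).1, (v (i, b)).2).
Proof. by rewrite permE /ins_fun liftK. Qed.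

Lemma ins_inj x : injective (ins x).
Proof.
move=> v1 v2 E; apply/permP=> -[i b].
have := congr1 (fun w : {perm _} => w (lift ord_max i, b)) E.
rewrite !ins_lift => /pair_equal_spec[/lift_inj E1 E2].
by rewrite [LHS]surjective_pairing E1 E2 -surjective_pairing.
Qed.

Lemma signed_permP m (w : {perm letter m}) :
  reflect (forall i b, w (i, ~~ b) = letter_opp (w (i, b)))
          (w \in signed_perm m).
Proof.
rewrite inE; apply: (iffP forallP) => [H i b|H [i b]].
  by have /eqP := H (i, b).
by rewrite H.
Qed.

(** A signed permutation with last letter [x] takes the values [x] and [- x]
    at its last position and its opposite only, so the other values can be unlifted to a
    signed permutation of size [n]. *)
Lemma signed_perm_ins x :
  [set w in signed_perm n.+1 | w (ord_max, false) == x]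
  = ins x @: signed_perm n.
Proof.
apply/setP=> w; rewrite inE; apply/andP/imsetP => [[]|[v /signed_permP sv ->]].
  move=> /signed_permP sw /eqP wx.
  have neq_x y : x.1 != (w (lift ord_max y.1, y.2)).1.
    apply/eqP=> E.
    have [b Eb] : exists b, w (ord_max, b) = w (lift ord_max y.1, y.2).
      exists (x.2 (+) (w (lift ord_max y.1, y.2)).2).
      rewrite [RHS]surjective_pairing -E.
      case Ex: x wx => [x1 x2] wx /=.
      case: x2 wx {Ex E}; case: (w (lift _ _, _)).2 => //= wx.
        by rewrite -[true]/(~~ false) sw wx.
      by rewrite -[true]/(~~ false) sw wx.
    by have /(congr1 fst)/eqP := perm_inj Eb; rewrite (negPf (neq_lift _ _)).
  have [f fE] : {f : letter n -> letter n | forall y,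
      (lift x.1 (f y).1, (f y).2) = w (lift ord_max y.1, y.2)}.
    exists (fun y : letter n => let z := w (lift ord_max y.1, y.2) in
      (odflt y.1 (unlift x.1 z.1), z.2)) => y /=.
    have [j Ej ->] := unlift_some (neq_x y).
    by rewrite /= -Ej -surjective_pairing.
  have f_inj : injective f.
    move=> y1 y2 E; have := fE y1.
    rewrite E fE => /perm_inj/pair_equal_spec[/lift_inj E1 E2].
    by rewrite [LHS]surjective_pairing -E1 -E2 -surjective_pairing.
  exists (perm f_inj).
    apply/signed_permP=> i b; rewrite !permE.
    have := fE (i, ~~ b); rewrite /= sw.
    have /= <- := fE (i, b).
    rewrite /letter_opp /= => /pair_equal_spec[/lift_inj E1 E2].
    by rewrite [LHS]surjective_pairing E1 E2.
  apply/permP=> -[i b]; case: (unliftP ord_max i) => [j ->|->].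
    by rewrite ins_lift permE; have /= -> := fE (j, b).
  rewrite ins_last; case: b; rewrite ?addbT ?addbF -?surjective_pairing //.
  by rewrite -[true]/(~~ false) sw wx.
rewrite ins_last addbF -surjective_pairing eqxx; split=> //.
apply/signed_permP => i b; case: (unliftP ord_max i) => [j ->|->].
  by rewrite !ins_lift sv.
by rewrite !ins_last /letter_opp /= addbN.
Qed.

Lemma big_signed_perm_ins (V : nmodType) (F : {perm letter n.+1} -> V) :
  \sum_(w in signed_perm n.+1) F w
  = \sum_(v in signed_perm n) \sum_(x : letter n.+1) F (ins x v).
Proof.
rewrite exchange_big /=.
pose last_letter (w : {perm letter n.+1}) := w (ord_max, false).
rewrite (partition_big last_letter predT) //=.
apply: eq_bigr => x _; rewrite -[RHS]big_imset /=; last first.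
  by move=> v1 v2 _ _; apply: ins_inj.
by rewrite -signed_perm_ins; apply: eq_bigl => w; rewrite !inE.
Qed.

Lemma sp_valS m (w : {perm letter m}) (i : 'I_m) :
  sp_val w i.+1 = letter_val (w (i, false)).
Proof. by rewrite /sp_val valK. Qed.

Lemma sp_val_ins x v i :
  (i <= n)%N -> sp_val (ins x v) i = bumpz x.1 (sp_val v i).
Proof.
case: i => [|i] lein; first by rewrite [RHS]bumpz0.
have -> : i = Ordinal lein by [].
rewrite [in RHS]sp_valS.
have -> : Ordinal lein = lift ord_max (Ordinal lein) :> nat.
  by rewrite /= /bump leqNgt lein.
by rewrite sp_valS ins_lift letter_val_lift.
Qed.

Lemma sp_val_ins_last x v : sp_val (ins x v) n.+1 = letter_val x.
Proof.
by rewrite (sp_valS (ins x v) ord_max) ins_last addbF -surjective_pairing.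
Qed.

Lemma invBE m (w : {perm letter m}) :
  invB w = (\sum_(j < m) (\sum_(i < j)
     ((sp_val w j.+1 < sp_val w i.+1)%R + (sp_val w j.+1 < - sp_val w i.+1)%R)
     + (sp_val w j.+1 < 0)%R))%N.
Proof.
have cardE (T : finType) (P : pred T) : #|[set x | P x]| = (\sum_x P x)%N.
  by rewrite -sum1dep_card big_mkcond.
have pairE (P : rel 'I_m) : (\sum_(p : 'I_m * 'I_m) ((p.1 < p.2)%N && P p.1 p.2)
    = \sum_(j < m) \sum_(i < m | (i < j)%N) P i j)%N.
  rewrite -(pair_bigA _ (fun i j : 'I_m => ((i < j)%N && P i j) : nat)) exchange_big.
  apply: eq_bigr => j _; rewrite [RHS]big_mkcond; apply: eq_bigr => i _ /=.
  by case: (i < j)%N.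
rewrite /invB !cardE.
rewrite (pairE (fun i j => (sp_val w j.+1 < sp_val w i.+1)%R)).
rewrite (pairE (fun i j => (sp_val w j.+1 < - sp_val w i.+1)%R)).
rewrite -!big_split; apply: eq_bigr => j _ /=; congr addn.
rewrite -big_split /=.
by rewrite (big_ord_widen m (fun i => ((sp_val w j.+1 < sp_val w i.+1)%R
  + (sp_val w j.+1 < - sp_val w i.+1)%R)%N)) 1?ltnW.
Qed.

(** The number of inversions created by a last letter [x], namely its rank from
    the top among the letters of size [n.+1].  It takes every value from 0 to
    [n.*2.+1] once, which is the source of the factors [2i]_q of B_n(1, q). *)
Definition letter_inv (x : letter n.+1) : nat :=
  if x.2 then (n.+1 + x.1)%N else (n - x.1)%N.

Lemma signed_perm_abs_inj m (v : {perm letter m}) :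
  v \in signed_perm m -> injective (fun i => (v (i, false)).1).
Proof.
move=> /signed_permP sv i j /= E.
have [E2|E2] := eqVneq (v (i, false)).2 (v (j, false)).2.
  suff /perm_inj[] : v (i, false) = v (j, false) by [].
  by rewrite [LHS]surjective_pairing E E2 -surjective_pairing.
suff /perm_inj[] : v (i, false) = v (j, true) by [].
rewrite -[true]/(~~ false) sv [LHS]surjective_pairing E /letter_opp.
by move: E2; case: (v (i, false)).2; case: (v (j, false)).2.
Qed.

(** The inversions of [v] are kept since [bumpz] is increasing and odd.  Those of
    the last letter depend on the absolute values of the other letters only,
    which are the integers up to [n.+1] other than that of [x], in some order. *)
Lemma invB_ins x v :
  v \in signed_perm n -> invB (ins x v) = (invB v + letter_inv x)%N.
Proof.
move=> sv; rewrite !invBE big_ord_recr /=; congr addn.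
  apply: eq_bigr => -[j ltjn] _ /=; rewrite (sp_val_ins _ _ ltjn); congr addn.
    apply: eq_bigr => -[i ltij] _ /=.
    by rewrite sp_val_ins ?(leq_trans ltij) 1?ltnW // -bumpzN !bumpz_mono.
  by rewrite -[in LHS](bumpz0 x.1) bumpz_mono.
pose D (j : 'I_n) := ((letter_val x < (lift x.1 j).+1%:Z)%R
   + (letter_val x < - (lift x.1 j).+1%:Z)%R)%N.
rewrite sp_val_ins_last.
have -> : (\sum_(i < n) ((letter_val x < sp_val (ins x v) i.+1)%R
    + (letter_val x < - sp_val (ins x v) i.+1)%R))%N = (\sum_(j < n) D j)%N.
  rewrite [RHS](reindex_inj (signed_perm_abs_inj sv)) /=; apply: eq_bigr => i _.
  rewrite sp_val_ins // sp_valS -letter_val_lift /D /letter_val /=.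
  by case: (v (i, false)) => a [] //=; rewrite opprK addnC.
have sum_ge k (lekn : (k <= n)%N) : (\sum_(j < n) (k <= j) = n - k)%N.
  rewrite -(big_mkord xpredT (fun j => (k <= j) : nat)).
  rewrite (big_cat_nat (leq0n k) lekn) //=.
  rewrite big_nat big1 => [|j /andP[_ ltjk]]; last by rewrite leqNgt ltjk.
  rewrite big_nat (eq_bigr (fun=> 1%N)) => [|j /andP[-> //]].
  by rewrite -big_nat sum_nat_const_nat muln1.
have sum_lt k (lekn : (k <= n)%N) : (\sum_(j < n) (j < k) = k)%N.
  apply: (@addnI (\sum_(j < n) (k <= j))%N); rewrite -big_split /=.
  rewrite (eq_bigr (fun=> 1%N)) => [|j _]; last by case: ltnP.
  by rewrite sum1_card card_ord sum_ge // subnK.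
have lekn : (x.1 <= n)%N by rewrite -ltnS.
(* A letter of absolute value greater than that of [x] contributes 1 for either
   sign of [x]; a smaller one contributes 2 if [x] is negative, 0 otherwise. *)
rewrite /letter_inv; case: x @D lekn {sv} => -[k ltkn] b D /= lekn.
case: b @D => D.
  transitivity ((\sum_(j < n) (1 + (j < k))) + 1)%N; last first.
    rewrite big_split /= sum1_card card_ord sum_lt //; lia.
  congr addn; apply: eq_bigr => j _; rewrite /D /letter_val /= /bump.
  case: leqP => ?; lia.
rewrite -(sum_ge k lekn) addn0; apply: eq_bigr => j _.
rewrite /D /letter_val /= /bump.
case: leqP => ?; lia.
Qed.

End Insertion.

(** * Sums with local weights on ascents and descents *)

Lemma big_letter (V : nmodType) n (F : letter n -> V) :
  \sum_x F x = \sum_(k < n) F (k, true) + \sum_(k < n) F (k, false).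
Proof.
rewrite -big_split /=; transitivity (\sum_k \sum_b F (k, b)).
  by rewrite pair_bigA; apply: eq_bigr => -[].
by apply: eq_bigr => k _; rewrite big_bool.
Qed.

Section Continuation.
Variables (K : fieldType) (q : K).
Implicit Type a : nat -> bool -> K.

Definition asc_weight a n (w : {perm letter n}) : K :=
  \prod_(i < n) a i (sp_val w i < sp_val w i.+1).

Definition asc_sum a n : K :=
  \sum_(w in signed_perm n) q ^+ invB w * asc_weight a w.

(** The sum over the ways to append [r] letters to a signed permutation of size
    [i] with last letter [z] ([z = 0] if [i = 0]), in terms of the new letters
    only. *)
Fixpoint continuation a (i r : nat) (z : int) : K :=
  if r is r'.+1 then
    \sum_(x : letter i.+1) q ^+ letter_inv x * a i (bumpz x.1 z < letter_val x)
       * continuation a i.+1 r' (letter_val x)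
  else 1.

Lemma asc_sum_continuation a m r :
  asc_sum a (m + r) = \sum_(v in signed_perm m)
    q ^+ invB v * asc_weight a v * continuation a m r (sp_val v m).
Proof.
elim: r m => [|r IHr] m.
  by rewrite addn0; apply: eq_bigr => v _; rewrite mulr1.
rewrite addnS -addSn IHr big_signed_perm_ins; apply: eq_bigr => v sv /=.
rewrite mulr_sumr; apply: eq_bigr => x _.
rewrite (invB_ins _ sv) exprD /asc_weight big_ord_recr /=.
rewrite sp_val_ins_last sp_val_ins //.
have -> : \prod_(i < m) a i (sp_val (ins x v) i < sp_val (ins x v) i.+1)
   = \prod_(i < m) a i (sp_val v i < sp_val v i.+1).
  apply: eq_bigr => i _; rewrite !sp_val_ins ?bumpz_mono //; exact: ltnW.
ring.
Qed.

Lemma signed_perm0 (w : {perm letter 0}) : (w \in signed_perm 0) = (w == 1%g).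
Proof.
have -> : w = 1%g by apply/permP => -[[]].
by rewrite eqxx; apply/signed_permP => -[].
Qed.

Lemma invB0 (w : {perm letter 0}) : invB w = 0%N.
Proof. by rewrite invBE big_ord0. Qed.

Lemma asc_sum_continuation0 a r : asc_sum a r = continuation a 0 r 0.
Proof.
rewrite -[r in LHS]add0n asc_sum_continuation (eq_bigl _ _ signed_perm0).
by rewrite big_pred1_eq invB0 /asc_weight big_ord0 !mul1r.
Qed.

(** From position [i] on, the weight is the indicator of an ascent. *)
Definition asc_from a i := forall j, (i <= j)%N -> a j =1 (fun b => b%:R).

Lemma asc_fromW a i j : (i <= j)%N -> asc_from a i -> asc_from a j.
Proof. by move=> leij ai l lejl; apply: ai; apply: leq_trans lejl. Qed.

(** The positive letters of size [i.+1] indexed by their number of inversions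
    [c = i - l]. *)
Lemma sum_positive_letters i N (f : nat -> K) : (N <= i.+1)%N ->
  \sum_(l < i.+1) q ^+ (i - l) * (i - l < N)%N%:R * f (i - l)%N
  = \sum_(c < N) q ^+ c * f c.
Proof.
move=> leNi; rewrite (big_ord_widen i.+1 (fun c => q ^+ c * f c)) //.
rewrite (reindex_inj rev_ord_inj) [RHS]big_mkcond /=; apply: eq_bigr => l _.
rewrite subSS subKn; last by rewrite -ltnS.
by case: ltnP => _; rewrite ?mulr1 // mulr0 mul0r.
Qed.

(** A letter that is greater than a positive one is positive, and positive
    letters increase exactly when their numbers of inversions [letter_inv]
    decrease weakly. *)
Lemma continuation_pos a i k r : asc_from a i -> (k < i)%N ->
  continuation a i r k.+1%:Z = qbin q (i - k.+1) r.
Proof.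
elim: r i k => // r IHr i k ai ltki.
rewrite /= big_letter big1 ?add0r => [|l _]; last first.
  rewrite ai // [_ < _]negbTE ?mulr0 ?mul0r // /letter_val /bumpz /=.
  by case: (ltP l%:Z k.+1%:Z) => ?; case: (ltP k.+1%:Z (- l%:Z)) => ?; lia.
rewrite qbinS -(@sum_positive_letters i (i - k.+1).+1 (fun c => qbin q c r)).
  2: by lia.
apply: eq_bigr => -[l ltli] _; rewrite ai //= -subSS.
rewrite -(IHr _ _ (asc_fromW (leqnSn i) ai)) //; congr (_ * _ * _).
congr (_%:R); rewrite /letter_val /bumpz /=.
by case: (ltP l%:Z k.+1%:Z) => ?; case: (ltP k.+1%:Z (- l%:Z)) => ?; lia.
Qed.

(** All the positive letters are allowed after the negative letter [- k.+1], and
    so are the negative ones [- l.+1] with [l <= k] (when [l = k], the previous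
    letter has been bumped to [- k.+2]): this is [neg_block_rec]. *)
Lemma continuation_neg a i k r : asc_from a i -> (k < i)%N ->
  continuation a i r (- k.+1%:Z) = neg_block q k i r.
Proof.
elim: r i k => [|r IHr] i k ai ltki.
  by rewrite neg_block0.
rewrite neg_block_rec /= big_letter; congr (_ + _).
  rewrite mulr_sumr.
  rewrite (big_ord_widen i.+1
    (fun l => q ^+ i.+1 * (q ^+ l * neg_block q l i.+1 r))) 1?ltnW //.
  rewrite [RHS]big_mkcond; apply: eq_bigr => -[l ltli] _ /=.
  rewrite ai // /letter_val /= IHr //; last exact: asc_fromW (leqnSn i) ai.
  rewrite mulrA -exprD mulrAC; case: ifP => Hl.
    rewrite [_ < _](_ : _ = true) ?mulr1 // /bumpz.
    by case: (ltP l%:Z (- k.+1%:Z)) => ?;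
    case: (ltP (- k.+1%:Z) (- l%:Z)) => ?; lia.
  rewrite [_ < _]negbTE ?mulr0 // /bumpz.
  by case: (ltP l%:Z (- k.+1%:Z)) => ?;
    case: (ltP (- k.+1%:Z) (- l%:Z)) => ?; lia.
rewrite qbinS -(@sum_positive_letters i i.+1 (fun c => qbin q c r)) //.
apply: eq_bigr => -[l ltli] _; rewrite ai //= -subSS.
rewrite -(continuation_pos _ (asc_fromW (leqnSn i) ai)) //; congr (_ * _ * _).
congr (_%:R); rewrite /letter_val /bumpz /=.
by case: (ltP l%:Z (- k.+1%:Z)) => ?;
    case: (ltP (- k.+1%:Z) (- l%:Z)) => ?; lia.
Qed.

(** The first of the [d] letters is arbitrary, as if it came after a negative
    letter [- m.+1]. *)
Lemma continuation_free a m d z :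
  (forall b, a m b = 1) -> asc_from a m.+1 ->
  continuation a m d z = neg_block q m m d.
Proof.
move=> am1 am; case: d => [|d]; first by rewrite neg_block0.
rewrite neg_block_rec /= big_letter mulr_sumr; congr (_ + _).
  apply: eq_bigr => -[l ltlm] _; rewrite am1 mulr1 /letter_val /=.
  by rewrite continuation_neg // exprD mulrA.
rewrite qbinS -(@sum_positive_letters m m.+1 (fun c => qbin q c d)) //.
apply: eq_bigr => -[l ltlm] _; rewrite am1 /= ltnS leq_subr -subSS.
by rewrite continuation_pos.
Qed.

(** The factorisation over a final increasing block: the sum over the block does
    not depend on what precedes it. *)
Lemma asc_sum_block a m d :
  (forall b, a m b = 1) -> asc_from a m.+1 ->
  asc_sum a (m + d) = asc_sum a m * neg_block q m m d.
Proof.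
move=> am1 am; rewrite asc_sum_continuation mulr_suml.
by apply: eq_bigr => v _; rewrite continuation_free.
Qed.

(** Only the identity has no descent. *)
Lemma asc_sum_all_asc a n : asc_from a 0 -> asc_sum a n = 1.
Proof.
move=> a0; rewrite asc_sum_continuation0; case: n => //= n.
rewrite big_letter !big_ord1 /letter_val /= a0 //=.
rewrite mulr0 mul0r add0r a0 // (@continuation_pos a 1 0) //.
  by rewrite qbin0l !mulr1.
exact: asc_fromW a0.
Qed.

Lemma asc_sum_const n : asc_sum (fun _ _ => 1) n = eulerB1 n q.
Proof.
by apply: eq_bigr => w _; rewrite /asc_weight big1 ?mulr1.
Qed.

(** The factors are the [2i]_q: the positive letters contribute [qint i.+1 q] and
    the negative ones [q ^+ i.+1] times as much. *)
Lemma eulerB1_prod n :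
  eulerB1 n q = \prod_(i < n) (qint i.+1 q * (1 + q ^+ i.+1)).
Proof.
elim: n => [|n IHn]; first by rewrite -asc_sum_const asc_sum_continuation0 big_ord0.
rewrite -asc_sum_const -addn1 asc_sum_continuation addn1 big_ord_recr /= -IHn.
rewrite /eulerB1 mulr_suml; apply: eq_bigr => v _.
rewrite /asc_weight big1 // mulr1 big_letter; congr (_ * _).
under eq_bigr do rewrite !mulr1 exprD /=.
under [X in _ + X]eq_bigr do rewrite !mulr1 /=.
rewrite -mulr_sumr mulrDr mulr1 addrC mulrC; congr (_ + _).
rewrite /qint (reindex_inj rev_ord_inj) /=; apply: eq_bigr => i _.
by rewrite /letter_inv /= subSS subKn // -ltnS.
Qed.

End Continuation.

(** * Coefficients of power series *)

Section FpsCoef.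
Variable K : fieldType.
Implicit Types g h : fps K.

Lemma fps_coefCM (z : K) g n : (z%:S * g)`[n] = z * g`[n].
Proof.
rewrite fps_coefM big_ord_recl /= subn0 big1 ?addr0 // => i _.
by rewrite mul0r.
Qed.

Lemma fps_coefM_sub1 g h n : h`[0] = 1 ->
  (g * (h - 1))`[n] = \sum_(j < n) g`[j] * h`[n - j].
Proof.
move=> h0; rewrite fps_coefM big_ord_recr subnn.
have -> : (h - 1)`[0] = 0 by rewrite fps_coefD fps_coefN fps_coef1 h0 subrr.
rewrite mulr0 [LHS]addr0.
apply: eq_bigr => j _; congr (_ * _); rewrite fps_coefD fps_coefN fps_coef1.
by rewrite /= subn_eq0 leqNgt ltn_ord subr0.
Qed.

End FpsCoef.

(** * The recurrence for the Eulerian polynomials *)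

Section Recurrence.
Variables (K : fieldType) (q : K).
Hypothesis qint_neq0 : forall j, qint j.+1 q != 0.

(** [1 + q ^+ i.+1] divides [qint (2 * i.+1) q]. *)
Lemma eulerB1_neq0 n : eulerB1 n q != 0.
Proof.
rewrite eulerB1_prod; apply/prodf_neq0 => i _; rewrite mulf_neq0 //.
have := qint_neq0 (i.+1 + i).
rewrite -addnS qintD -{1}[qint i.+1 q]mul1r -mulrDl.
by rewrite mulf_eq0 => /norP[].
Qed.

Lemma eulerB1_block m d :
  eulerB1 (m + d) q = eulerB1 m q * neg_block q m m d * qfact d q.
Proof.
rewrite -mulrA neg_block_qfact // !eulerB1_prod big_split_ord /=.
by congr (_ * _); apply: eq_bigr.
Qed.

Lemma sp_val_neq n (w : {perm letter n}) (i : 'I_n) : w \in signed_perm n ->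
  sp_val w i != sp_val w i.+1.
Proof.
move=> sw; have val_abs (x : letter n) : `|letter_val x|%N = x.1.+1.
  by case: x => [j []] /=; rewrite /letter_val /=; lia.
case: i => -[|i] ltin; rewrite (sp_valS w (Ordinal ltin)).
  by apply/eqP => /(congr1 absz); rewrite val_abs.
rewrite (sp_valS w (Ordinal (ltnW ltin))).
apply/eqP => /(congr1 absz); rewrite !val_abs.
by move=> -[] /val_inj /(signed_perm_abs_inj sw) []; lia.
Qed.

Definition alt (z0 z1 : K) (i : nat) : K := if odd i then z1 else z0.

Lemma eulerB_asc_sum n s0 s1 t0 t1 :
  eulerB n s0 s1 t0 t1 q
  = asc_sum q (fun i b => if b then alt s0 s1 i else alt t0 t1 i) n.
Proof.
apply: eq_bigr => w sw; rewrite [RHS]mulrC; congr (_ * _).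
have expE (P : pred 'I_n) (z : K) :
    z ^+ #|[set i | P i]| = \prod_(i < n) (if P i then z else 1).
  by rewrite -prodr_const big_mkcond; apply: eq_bigr => i _; rewrite inE.
rewrite /eascB /oascB /edesB /odesB !expE -!big_split; apply: eq_bigr => i _ /=.
rewrite /alt; have := sp_val_neq i sw.
by case: ltgtP => //= _ _; case: (odd i); rewrite /= ?mulr1 ?mul1r.
Qed.

(** The expansion of a product of sums according to the last factor [j] of which
    the first summand is taken. *)
Lemma prod_add_expand n (t y : nat -> K) :
  \prod_(i < n) (t i + y i) = \prod_(i < n) y i
    + \sum_(j < n) \prod_(i < n)
        (if (i < j)%N then t i + y i else if i == j :> nat then t i else y i).
Proof.
elim: n => [|n IHn]; first by rewrite !big_ord0 addr0.
rewrite big_ord_recr IHn /= mulrDr -IHn !big_ord_recr /= ltnn eqxx addrA.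
rewrite [X in _ = _ + X](_ : _ = \prod_(i < n) (t i + y i) * t n).
  rewrite [LHS]addrC; congr (_ + _).
  rewrite IHn mulrDl mulr_suml; congr (_ + _); apply: eq_bigr => j _.
  rewrite big_ord_recr /= ltnNge ltnW //= gtn_eqF //.
by congr (_ * _); apply: eq_bigr => i _; rewrite ltn_ord.
Qed.

Lemma asc_sum_scale (c : nat -> K) (a : nat -> bool -> K) n :
  asc_sum q (fun i b => c i * a i b) n = (\prod_(i < n) c i) * asc_sum q a n.
Proof.
rewrite mulr_sumr; apply: eq_bigr => w _.
by rewrite /asc_weight big_split mulrCA.
Qed.

Lemma eq_asc_sum n (a a' : nat -> bool -> K) :
  (forall i, (i < n)%N -> a i =1 a' i) -> asc_sum q a n = asc_sum q a' n.
Proof.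
move=> aa'; apply: eq_bigr => w _; congr (_ * _).
by apply: eq_bigr => i _; apply: aa'.
Qed.

Variables s0 s1 t0 t1 : K.
Notation x0 := (s0 - t0).
Notation x1 := (s1 - t1).
Notation f n := (eulerB n s0 s1 t0 t1 q / eulerB1 n q).

Lemma eulerB_recurrence n :
  f n = (\prod_(0 <= i < n) alt x0 x1 i) / eulerB1 n q
    + \sum_(j < n) f j * alt t0 t1 j * \prod_(j.+1 <= i < n) alt x0 x1 i
                   / qfact (n - j) q.
Proof.
(* The term of index [j] has the weights [a j] up to the scalars [c j]: those of
   the Eulerian polynomial before [j], none at [j], ascents after [j]. *)
pose a j i (b : bool) : K :=
  if (i < j)%N then (if b then alt s0 s1 i else alt t0 t1 i)
  else if i == j then 1 else b%:R.
pose c j i : K :=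
  if (i < j)%N then 1 else if i == j then alt t0 t1 i else alt x0 x1 i.
have split_sum : eulerB n s0 s1 t0 t1 q = \prod_(0 <= i < n) alt x0 x1 i
    + \sum_(j < n) (\prod_(i < n) c j i) * asc_sum q (a j) n.
  have -> : \prod_(0 <= i < n) alt x0 x1 i
      = asc_sum q (fun i b => alt x0 x1 i * b%:R) n.
    by rewrite asc_sum_scale asc_sum_all_asc // mulr1 big_mkord.
  under eq_bigr do rewrite -asc_sum_scale.
  rewrite eulerB_asc_sum exchange_big -big_split; apply: eq_bigr => w _ /=.
  rewrite -mulr_sumr -mulrDr; congr (_ * _).
  rewrite /asc_weight.
  pose yw i := if sp_val w i < sp_val w i.+1 then alt x0 x1 i else 0.
  transitivity (\prod_(i < n) (alt t0 t1 i + yw i)).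
    apply: eq_bigr => i _; rewrite /yw /alt.
    by case: (sp_val w i < _); case: (odd i); rewrite ?addr0 // addrC subrK.
  rewrite prod_add_expand; congr (_ + _).
    apply: eq_bigr => i _; rewrite /yw.
    by case: (sp_val w i < _); rewrite ?mulr1 ?mulr0.
  apply: eq_bigr => j _; apply: eq_bigr => i _; rewrite /c /a /yw /alt.
  case: ltnP => _.
    rewrite mul1r.
    by case: (sp_val w i < _); case: (odd i); rewrite ?addr0 // addrC subrK.
  by case: eqP => _; case: (sp_val w i < sp_val w i.+1); rewrite ?mulr1 ?mulr0.
rewrite {1}split_sum mulrDl mulr_suml; congr (_ + _); apply: eq_bigr => j _.
have -> : \prod_(i < n) c j i = alt t0 t1 j * \prod_(j.+1 <= i < n) alt x0 x1 i.
  rewrite -(big_mkord xpredT (c j)) (big_cat_nat (leq0n j)) 1?ltnW //=.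
  rewrite big_nat big1 ?mul1r => [|i /andP[_ ltij]]; last by rewrite /c ltij.
  rewrite big_ltn // {1}/c ltnn eqxx; congr (_ * _).
  apply: eq_big_nat => i /andP[ltji _].
  by rewrite /c ltnNge ltnW //= gtn_eqF.
have lejn : (j <= n)%N by apply: ltnW.
have -> : asc_sum q (a j) n = asc_sum q (a j) j * neg_block q j j (n - j).
  rewrite -asc_sum_block ?subnKC // => [b|i ltji b]; first by rewrite /a ltnn eqxx.
  by rewrite /a ltnNge ltnW //= gtn_eqF.
have -> : eulerB1 n q = eulerB1 j q * neg_block q j j (n - j) * qfact (n - j) q.
  by rewrite -eulerB1_block subnKC.
have -> : asc_sum q (a j) j = eulerB j s0 s1 t0 t1 q.
  by rewrite eulerB_asc_sum; apply: eq_asc_sum => i ltij b; rewrite /a ltij.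
have Bj := eulerB1_neq0 j; have Q := qfact_neq0 qint_neq0 (n - j).
have N : neg_block q j j (n - j) != 0.
  have := eulerB1_neq0 (j + (n - j)).
  by rewrite eulerB1_block !mulf_eq0 !negb_or -andbA => /and3P[].
by field; rewrite Bj Q N.
Qed.

Variable c : K.
Hypothesis cE : c ^+ 2 = x0 * x1.

(** The coefficients of [H0] and [H1] in [fps_eulerB_eq].  With this factor,
    the products of consecutive [x_i] become powers of [c], up to the same factor
    at the other end. *)
Let parity_scale n := if odd n then x1 * c else x0 * x1.

Lemma parity_scale_prod j n : (j <= n)%N ->
  parity_scale n * \prod_(j <= i < n) alt x0 x1 i = parity_scale j * c ^+ (n - j).
Proof.
elim: n => [|n IHn]; first by rewrite leqn0 => /eqP->; rewrite big_geq.
rewrite leq_eqVlt => /predU1P[->|lejn]; first by rewrite big_geq // subnn.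
rewrite big_nat_recr //= subSn // exprSr [RHS]mulrA -(IHn lejn).
rewrite /parity_scale /alt /=.
case: (odd n) => /=; last by ring.
by rewrite -!mulrA [RHS]mulrCA [c * _]mulrC -!mulrA -expr2 cE; ring.
Qed.

(** Coefficientwise, this is [eulerB_recurrence] multiplied by [parity_scale n];
    subtracting 1 from the q-exponential removes the term [j = n] of the
    convolution. *)
Lemma fps_eulerB_eq :
  (x0 * x1)%:S * H0 s0 s1 t0 t1 q + (x1 * c)%:S * H1 s0 s1 t0 t1 q
  = (x0 * x1)%:S * fps_at (exp_B q) c
    + ((t0 * x1)%:S * H0 s0 s1 t0 t1 q + (t1 * c)%:S * H1 s0 s1 t0 t1 q)
      * (fps_at (exp_q q) c - 1).
Proof.
apply/fpsP => n; rewrite !fps_coefD !fps_coefCM fps_coefM_sub1; last first.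
  by rewrite /= qfact0 invr1 mul1r.
transitivity (parity_scale n * f n).
  by rewrite /parity_scale /=; case: (odd n); rewrite mulr0 ?addr0 ?add0r.
rewrite {1}eulerB_recurrence mulrDr mulrA parity_scale_prod // subn0 mulr_sumr.
congr (_ + _).
  by rewrite /parity_scale /= -!mulrA [_^-1 * _]mulrC.
apply: eq_bigr => j _; rewrite fps_coefD !fps_coefCM /=.
set p := \prod_(_ <= _ < _) _; set r := qfact _ _.
have -> : parity_scale n * (f j * alt t0 t1 j * p / r)
    = parity_scale n * p * f j * alt t0 t1 j / r by ring.
rewrite {}/p {}/r.
rewrite parity_scale_prod // -(subnSK (ltn_ord j)) exprS /parity_scale /alt /=.
case: (odd j) => /=; rewrite ?mulr0 ?addr0 ?add0r; [rewrite -cE|]; ring.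
Qed.

End Recurrence.

(** * The linear system for the two series *)

(** The half sum and the half difference of the two equations are [even_eq] and
    [odd_eq] below, a linear system in [h0] and [h1] with determinant [den] up to
    the factor [x1 * m]. *)
Lemma parity_system_solution (R : comUnitRingType) (s0 s1 t0 t1 m h0 h1 ep em
    bp bm : R) :
  let x0 := s0 - t0 in let x1 := s1 - t1 in
  let C := (ep + em) / 2%:R in let S := (ep - em) / 2%:R in
  let CB := (bp + bm) / 2%:R in let SB := (bp - bm) / 2%:R in
  let den := s0 * s1 - (t0 * s1 + s0 * t1) * C + t0 * t1 * ep * em in
  2%:R \is a @GRing.unit R -> m \is a GRing.unit -> x0 \is a GRing.unit ->
  den \is a GRing.unit -> m ^+ 2 = x0 * x1 ->
  x0 * x1 * h0 + x1 * m * h1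
    = x0 * x1 * bp + (t0 * x1 * h0 + t1 * m * h1) * (ep - 1) ->
  x0 * x1 * h0 - x1 * m * h1
    = x0 * x1 * bm + (t0 * x1 * h0 - t1 * m * h1) * (em - 1) ->
  h0 / x0 = ((s1 - t1 * C) * CB + t1 * S * SB) / den
  /\ h1 = m * ((s0 - t0 * C) * SB + t0 * S * CB) / den.
Proof.
move=> x0 x1 C S CB SB den U2 Um Ux Ud mE Ep Em.
have half2 (z : R) : z / 2%:R + z / 2%:R = z.
  by rewrite -mulr2n -[_ *+ 2]mulr_natr divrK.
have epE : ep = C + S by rewrite -[LHS]half2 /C /S; ring.
have emE : em = C - S by rewrite -[LHS]half2 /C /S; ring.
have bpE : bp = CB + SB by rewrite -[LHS]half2 /CB /SB; ring.
have bmE : bm = CB - SB by rewrite -[LHS]half2 /CB /SB; ring.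
have denE : den = (s0 - t0 * C) * (s1 - t1 * C) - t0 * t1 * S ^+ 2.
  by rewrite /den epE emE; ring.
have Ux1 : x1 \is a GRing.unit.
  by move: (unitrX 2 Um); rewrite mE unitrM => /andP[].
have dbl (y z : R) : y * 2%:R = z * 2%:R -> y = z by apply: mulIr.
have even_eq : x1 * (s0 - t0 * C) * h0 = m ^+ 2 * CB + t1 * m * S * h1.
  apply: dbl; have := congr2 +%R Ep Em; rewrite epE emE bpE bmE mE => EE.
  apply/eqP; rewrite -subr_eq0; move/eqP: EE; rewrite -subr_eq0 => /eqP <-.
  by apply/eqP; rewrite /x0 /x1; ring.
have odd_eq : m * (s1 - t1 * C) * h1 = m ^+ 2 * SB + t0 * x1 * S * h0.
  apply: dbl; have := congr2 (fun y z => y - z) Ep Em.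
  rewrite epE emE bpE bmE mE => EE.
  apply/eqP; rewrite -subr_eq0; move/eqP: EE; rewrite -subr_eq0 => /eqP <-.
  by apply/eqP; rewrite /x0 /x1; ring.
have h0_den : h0 * den = x0 * ((s1 - t1 * C) * CB + t1 * S * SB).
  apply: (mulrI Ux1).
  have -> : x1 * (h0 * den) = (x1 * (s0 - t0 * C) * h0) * (s1 - t1 * C)
      - t1 * S * (t0 * x1 * S * h0) by rewrite denE; ring.
  rewrite even_eq [RHS]mulrA [x1 * x0]mulrC -mE.
  have -> : t0 * x1 * S * h0 = m * (s1 - t1 * C) * h1 - m ^+ 2 * SB.
    by rewrite odd_eq addrC addKr.
  by ring.
have h1_den : h1 * den = m * ((s0 - t0 * C) * SB + t0 * S * CB).
  apply: (mulrI Um).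
  have -> : m * (h1 * den) = (m * (s1 - t1 * C) * h1) * (s0 - t0 * C)
      - t0 * S * (t1 * m * S * h1) by rewrite denE; ring.
  rewrite odd_eq.
  have -> : t1 * m * S * h1 = x1 * (s0 - t0 * C) * h0 - m ^+ 2 * CB.
    by rewrite even_eq addrC addKr.
  by ring.
split; first by rewrite -[h0](mulrK Ud) h0_den mulrAC [x0 * _]mulrC mulrK.
by rewrite -h1_den mulrK.
Qed.

(** * Nonvanishing in the field of rational functions *)

Section Indet.
Variable K : fieldExtType Qstq.

Definition ev_mpoly (p : {mpoly rat[5]}) : K := (tofrac p)%:A.

(** A polynomial in the indeterminates is nonzero as soon as it has a nonzero
    value at some rational point. *)
Lemma ev_mpoly_neq0 (v : 'I_5 -> rat) (p : {mpoly rat[5]}) :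
  p.@[v] != 0 -> ev_mpoly p != 0.
Proof.
move=> pv; rewrite /ev_mpoly scaler_eq0 oner_eq0 orbF tofrac_eq0.
by apply: contraNneq pv => ->; rewrite meval0.
Qed.

Lemma indet_qint_neq0 j : qint j.+1 ((indet 4)%:A : K) != 0.
Proof.
pose p : {mpoly rat[5]} := \sum_(i < j.+1) 'X_(inord 4) ^+ i.
have -> : qint j.+1 ((indet 4)%:A : K) = ev_mpoly p.
  rewrite /ev_mpoly -[RHS]/(in_alg K _) !rmorph_sum; apply: eq_bigr => i _.
  by rewrite !rmorphXn.
apply: (@ev_mpoly_neq0 (fun=> 1)).
rewrite raddf_sum /= (eq_bigr (fun=> 1)) => [|i _].
  by rewrite sumr_const card_ord pnatr_eq0.
by rewrite rmorphXn /= mevalXU expr1n.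
Qed.

Lemma indet_sub_neq0 i j : (i < 5)%N -> (j < 5)%N -> i != j ->
  (indet i)%:A - (indet j)%:A != 0 :> K.
Proof.
move=> lti ltj neq_ij.
have -> : (indet i)%:A - (indet j)%:A = ev_mpoly ('X_(inord i) - 'X_(inord j)).
  by rewrite /ev_mpoly rmorphB scalerBl.
apply: (@ev_mpoly_neq0 (fun k => (k == i :> nat)%:R)).
rewrite mevalB !mevalXU !inordK // eqxx [j == i]eq_sym (negPf neq_ij).
by rewrite subr0 oner_eq0.
Qed.

Lemma two_neq0 : 2%:R != 0 :> K.
Proof.
have -> : 2%:R = ev_mpoly 2%:R :> K.
  by rewrite /ev_mpoly -[RHS]/(in_alg K _) !rmorph_nat.
by apply: (@ev_mpoly_neq0 (fun=> 0)); rewrite rmorph_nat.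
Qed.

End Indet.

Unset Implicit Arguments.

Theorem theorem23 (K : fieldExtType Qstq) (m : K) :
  let s0 : K := (indet 0)%:A in
  let s1 : K := (indet 1)%:A in
  let t0 : K := (indet 2)%:A in
  let t1 : K := (indet 3)%:A in
  let q : K := (indet 4)%:A in
  m ^+ 2 = (s0 - t0) * (s1 - t1) ->
  let cosh_q := cosh_of (exp_q q) m in
  let sinh_q := sinh_of (exp_q q) m in
  let cosh_B := cosh_of (exp_B q) m in
  let sinh_B := sinh_of (exp_B q) m in
  let den := (s0 * s1)%:S - (t0 * s1 + s0 * t1)%:S * cosh_q
             + (t0 * t1)%:S * fps_at (exp_q q) m * fps_at (exp_q q) (- m) in
  H0 s0 s1 t0 t1 q / (s0 - t0)%:S
    = ((s1%:S - t1%:S * cosh_q) * cosh_B + t1%:S * sinh_q * sinh_B) / den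
  /\ H1 s0 s1 t0 t1 q
    = m%:S * ((s0%:S - t0%:S * cosh_q) * sinh_B + t0%:S * sinh_q * cosh_B) / den.
Proof.
move=> s0 s1 t0 t1 q mE cosh_q sinh_q cosh_B sinh_B den.
have x0_neq0 : s0 - t0 != 0 by apply: indet_sub_neq0.
have x1_neq0 : s1 - t1 != 0 by apply: indet_sub_neq0.
have m_neq0 : m != 0.
  by apply: contraNneq (mulf_neq0 x0_neq0 x1_neq0) => m0; rewrite -mE m0 expr0n.
have unitC (z : K) : z != 0 -> z%:S \is a GRing.unit.
  by move=> z_neq0; rewrite fps_unitE unitfE.
have unit2 : (2%:R : fps K) \is a GRing.unit.
  by rewrite -(rmorph_nat (@fpsC K)) unitC ?two_neq0.
have coef0M (f g : fps K) : (f * g)`[0] = f`[0] * g`[0].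
  by rewrite fps_coefM big_ord1.
have e0 (z : K) : (fps_at (exp_q q) z)`[0] = 1 by rewrite /= qfact0 invr1 mulr1.
have cosh0 : cosh_q`[0] = 1.
  have : (cosh_q * 2%:R)`[0] = 2%:R by rewrite divrK // fps_coefD !e0.
  rewrite coef0M -(rmorph_nat (@fpsC K)) => /(canRL (mulfK (two_neq0 K))).
  by rewrite divff // two_neq0.
have unit_den : den \is a GRing.unit.
  suff unit_gen (C : fps K) : C`[0] = 1 ->
      (s0 * s1)%:S - (t0 * s1 + s0 * t1)%:S * C
        + (t0 * t1)%:S * fps_at (exp_q q) m * fps_at (exp_q q) (- m)
      \is a GRing.unit by apply: unit_gen cosh0.
  move=> C0; rewrite fps_unitE unitfE !fps_coefD fps_coefN !coef0M !e0 C0 /= !mulr1.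
  rewrite [X in X != 0](_ : _ = (s0 - t0) * (s1 - t1)) ?mulf_neq0 //; ring.
have mNE : (- m) ^+ 2 = (s0 - t0) * (s1 - t1) by rewrite sqrrN.
have qint_neq0 j : qint j.+1 q != 0 by apply: indet_qint_neq0.
have Ep := fps_eulerB_eq qint_neq0 mE.
have Em := fps_eulerB_eq qint_neq0 mNE.
have x0E : (s0 - t0)%:S = s0%:S - t0%:S by rewrite rmorphB.
have x1E : (s1 - t1)%:S = s1%:S - t1%:S by rewrite rmorphB.
rewrite {1}x0E /den !(rmorphD, rmorphM) /=.
apply: parity_system_solution => //.
- by rewrite unitC.
- by rewrite -x0E unitC.
- by move: unit_den; rewrite /den !(rmorphD, rmorphM).
- by rewrite -rmorphXn mE rmorphM /= x0E x1E.
- by move: Ep; rewrite !rmorphM /= x0E x1E.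
- by move: Em; rewrite !rmorphM /= x0E x1E rmorphN /= !mulrN !mulNr.
Qed.
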